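(* Let $I\subset\mathbb{R}$ be a nondegenerate interval, let $n\in\mathbb{N}$, let $\omega=(\omega_1,\dots,\omega_n):I\to\mathbb{R}^n$ be an $n$-dimensional positive Chebyshev system over $I$, and let $\omega_{n+1}:I\to\mathbb{R}$ be such that $\omega^*=(\omega_1,\dots,\omega_n,\omega_{n+1})$ is an $(n+1)$-dimensional positive Chebyshev system over $I$. Let $f:I\to\mathbb{R}$. Then, for every $(x_0,\dots,x_n)\in\sigma_{n+1}(I)$, there exists $p\in[x_0,x_n]$ such that $$\big[x_0,\dots,x_n;f\big]_{\omega^*}\ge\underline{D}_{\,\omega^*}f(p).$$
   Context: $\mathbb{N}$ is the set of positive integers. $\sigma_k(I):=\{(x_1,\dots,x_k)\in I^k\mid x_1<\dots<x_k\}$. For $\omega=(\omega_1,\dots,\omega_k):I\to\mathbb{R}^k$ and $(x_1,\dots,x_k)\in\sigma_k(I)$, $\Phi_\omega(x_1,\dots,x_k):=\det\big(\omega_i(x_j)\big)_{i,j=1}^k$. $\omega$ is a $k$-dimensional positive Chebyshev system over $I$ if $\Phi_\omega>0$ on $\sigma_k(I)$. For an $n$-dimensional $\omega$ and $f:I\to\mathbb{R}$, $(\omega,f):=(\omega_1,\dots,\omega_n,f)$, and $$[x_0,\dots,x_n;f]_{\omega^*}:=\frac{\Phi_{(\omega,f)}(x_0,\dots,x_n)}{\Phi_{\omega^*}(x_0,\dots,x_n)}\qquad\text{for }(x_0,\dots,x_n)\in\sigma_{n+1}(I).$$ For $p\in I$, the lower Dinghas type derivative (an extended real number) is $$\underline{D}_{\,\omega^*}f(p):=\lim_{\delta\to0^+}\inf\big\{[x_0,\dots,x_n;f]_{\omega^*}: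 (x_0,\dots,x_n)\in\sigma_{n+1}(I),\ x_0\le p\le x_n,\ x_n-x_0<\delta\big\}.$$ *)

(* Defs.v *)
From HB Require Import structures.
From mathcomp Require Import all_boot all_order all_algebra.
From mathcomp Require Import all_classical all_reals all_analysis.
Set Implicit Arguments.
Unset Strict Implicit.
Unset Printing Implicit Defensive.
Import Order.TTheory GRing.Theory Num.Theory.
Import numFieldNormedType.Exports.
Local Open Scope classical_set_scope.
Local Open Scope ring_scope.

(* A function on the interval I is represented by a total function on R whose
   values outside I are never used. *)

Definition nondegenerate_interval (R : realType) (I : set R) : Prop :=
  is_interval I /\ exists a b, [/\ I a, I b & a < b].

Definition simplex (R : realType) (k : nat) (I : set R) : set ('I_k -> R) :=
  [set x : 'I_k -> R | (forall i, I (x i)) /\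
                       (forall i j : 'I_k, (i < j)%N -> x i < x j)].

Definition Phi (R : realType) (k : nat) (omega : 'I_k -> R -> R)
  (x : 'I_k -> R) : R := \det (\matrix_(i, j) omega i (x j)).

Definition positive_Chebyshev (R : realType) (k : nat) (I : set R)
    (omega : 'I_k -> R -> R) : Prop :=
  forall x, simplex I x -> 0 < Phi omega x.

(* The system (omega_1, ..., omega_k, g). *)
Definition extend (R : realType) (k : nat) (omega : 'I_k -> R -> R)
    (g : R -> R) : 'I_k.+1 -> R -> R :=
  fun i => if unlift ord_max i is Some j then omega j else g.

(* [x_0, ..., x_n; f]_{omega^*} with omega^* = (omega, w). *)
Definition divided_difference (R : realType) (n : nat) (omega : 'I_n -> R -> R)
    (w f : R -> R) (x : 'I_n.+1 -> R) : R :=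
  Phi (extend omega f) x / Phi (extend omega w) x.

(* The infimum is nonincreasing in delta, so the limit always exists in \bar R.
   When I is a nondegenerate interval, p is in I and delta > 0, the infimum is
   over a nonempty set, so the convention inf set0 = +oo plays no role. *)
Definition lower_Dinghas (R : realType) (n : nat) (I : set R)
    (omega : 'I_n -> R -> R) (w f : R -> R) (p : R) : \bar R :=
  lim (ereal_inf [set (divided_difference omega w f x)%:E
         | x in [set x : 'I_n.+1 -> R | [/\ simplex I x,
                   x ord0 <= p <= x ord_max & x ord_max - x ord0 < delta]]]
       @[delta --> (0 : R)^'+]).

(* Main.v *)
(* Put c = [x; f] and g = f - c w, so that [y; f] <= c iff Phi_(omega, g)(y) <= 0.
   If a point is inserted inside such a tuple y, then among the two tuples
   obtained by dropping the first or the last of the n+2 points, one again has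
   Phi_(omega, g) <= 0.  Inserting the points of a fine grid one by one yields
   arbitrarily short tuples inside y; iterating gives nested tuples shrinking
   to a point p, with [.; f] <= c all along. *)
Require Import Defs.
From mathcomp Require Import all_boot all_order all_algebra.
From mathcomp Require Import all_classical all_reals all_analysis.
From mathcomp Require Import lra ring zify.
Import Order.TTheory GRing.Theory Num.Theory.
Import numFieldNormedType.Exports.
Local Open Scope classical_set_scope.
Local Open Scope ring_scope.

Set Implicit Arguments.
Unset Strict Implicit.

(** * Determinants of a system extended by one function *)

Lemma extend_lift (R : realType) (n : nat) (omega : 'I_n -> R -> R)
  (g : R -> R) (i : 'I_n) : extend omega g (lift ord_max i) = omega i.
Proof. by rewrite /extend liftK. Qed.

Lemma extend_max (R : realType) (n : nat) (omega : 'I_n -> R -> R)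
  (g : R -> R) : extend omega g ord_max = g.
Proof. by rewrite /extend unlift_none. Qed.


Lemma simplex_lift (R : realType) (n : nat) (I : set R) (y : 'I_n.+1 -> R)
  (k : 'I_n.+1) : simplex I y -> @simplex R n I (y \o lift k).
Proof.
move=> [Iy ylt]; split=> [i|i j ij]; first exact: Iy.
by apply: ylt; rewrite /= /bump; lia.
Qed.

Lemma simplex_le (R : realType) (n : nat) (I : set R) (y : 'I_n -> R)
  (i j : 'I_n) : simplex I y -> (i <= j)%N -> y i <= y j.
Proof.
move=> [_ ylt]; rewrite leq_eqVlt => /orP[/eqP/val_inj->//|ij].
exact/ltW/ylt.
Qed.

(** Laplace expansion along the last row. The cofactors involve only [omega], so the determinant is
    linear in [g] and depends only on the values of [g] at the points. *)
Lemma Phi_extendE (R : realType) (n : nat) (omega : 'I_n -> R -> R)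
  (g : R -> R) (y : 'I_n.+1 -> R) :
  Phi (extend omega g) y =
  \sum_j g (y j) * ((-1) ^+ (n + j) * Phi omega (y \o lift j)).
Proof.
rewrite /Phi (expand_det_row _ ord_max); apply: eq_bigr => j _.
rewrite mxE extend_max /cofactor /=; congr (_ * (_ * _)).
by congr (\det _); apply/matrixP => a b; rewrite !mxE extend_lift.
Qed.

Lemma Phi_extend_comb (R : realType) (n : nat) (omega : 'I_n -> R -> R)
  (g h : R -> R) (c : R) (y : 'I_n.+1 -> R) :
  Phi (extend omega (fun t => g t - c * h t)) y =
  Phi (extend omega g) y - c * Phi (extend omega h) y.
Proof.
rewrite !Phi_extendE mulr_sumr -sumrB; apply: eq_bigr => j _; ring.
Qed.

(** By linearity it suffices that adjoining some [omega i] repeats a row. This allows [g] to be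
    replaced by its interpolation error. *)
Lemma Phi_extend_sub_span (R : realType) (n : nat) (omega : 'I_n -> R -> R)
  (g : R -> R) (a : 'I_n -> R) (y : 'I_n.+1 -> R) :
  Phi (extend omega (fun t => g t - \sum_i a i * omega i t)) y =
  Phi (extend omega g) y.
Proof.
have Phi_in i : Phi (extend omega (omega i)) y = 0.
  apply: (@determinant_alternate _ _ _ (lift ord_max i) ord_max) => [|j].
    by rewrite eq_sym neq_lift.
  by rewrite !mxE extend_lift extend_max.
transitivity (Phi (extend omega g) y -
    \sum_i a i * Phi (extend omega (omega i)) y); last first.
  by rewrite big1 ?subr0 // => i _; rewrite Phi_in mulr0.
rewrite !Phi_extendE; under [X in _ = _ - X]eq_bigr do
  rewrite Phi_extendE mulr_sumr.
rewrite exchange_big -sumrB; apply: eq_bigr => j _ /=.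
rewrite mulrBl mulr_suml; congr (_ - _); apply: eq_bigr => i _.
by rewrite -mulrA.
Qed.

(** The collocation matrix at [v] has positive determinant, hence is invertible; [a] solves the
    resulting linear system. *)
Lemma Chebyshev_interpolation (R : realType) (n : nat) (I : set R)
  (omega : 'I_n -> R -> R) (homega : positive_Chebyshev I omega)
  (g : R -> R) (v : 'I_n -> R) (hv : simplex I v) :
  exists a : 'I_n -> R, forall j, \sum_i a i * omega i (v j) = g (v j).
Proof.
pose M := \matrix_(i, j) omega i (v j).
have uM : M \in unitmx by rewrite unitmxE unitfE gt_eqF //; exact: homega.
exists (((\row_j g (v j)) *m invmx M) 0) => j.
have /matrixP/(_ 0 j) := mulmxKV uM (\row_j g (v j)).
rewrite mxE [X in _ = X]mxE => <-; apply: eq_bigr => i _.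
by rewrite [M i j]mxE.
Qed.

(* Subtracting the interpolant of g at the interior points u_1, ..., u_n leaves
   the determinants unchanged, and kills all their last-row entries except
   those at u_0 and u_{n+1}. *)
Lemma Phi_extend_interior (R : realType) (n : nat) (hn : (0 < n)%N)
  (I : set R) (omega : 'I_n -> R -> R) (homega : positive_Chebyshev I omega)
  (g : R -> R) (u : 'I_n.+2 -> R) (hu : simplex I u) (k : 'I_n.+2)
  (hk : (0 < k < n.+1)%N) :
  0 < Phi (extend omega g) (u \o lift ord0) ->
  0 < Phi (extend omega g) (u \o lift ord_max) ->
  0 < Phi (extend omega g) (u \o lift k).
Proof.
have hv : @simplex R n I (u \o lift ord_max \o lift ord0).
  by do 2!apply: simplex_lift.
have [a ag] := Chebyshev_interpolation homega g hv.
rewrite -!(Phi_extend_sub_span omega g a).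
set h := (fun t => _ - _).
(* The interpolation node with index [i.-1] is the interior point [u i]. *)
have h0 (i : 'I_n.+2) : (0 < i < n.+1)%N -> h (u i) = 0.
  move=> /andP[i0 iS]; have jn : (i.-1 < n)%N by lia.
  have := ag (Ordinal jn); rewrite /h => /eqP; rewrite eq_sym -subr_eq0 /=.
  suff -> : lift ord_max (lift ord0 (Ordinal jn)) = i by move/eqP.
  by apply/val_inj; rewrite /= /bump; lia.
have Opos (l : 'I_n.+2) (j : 'I_n.+1) : 0 < Phi omega (u \o lift l \o lift j).
  by apply: homega; do 2!apply: simplex_lift.
have PhiE (l : 'I_n.+2) : Phi (extend omega h) (u \o lift l) =
    h (u (lift l ord0)) *
      ((-1) ^+ n * Phi omega (u \o lift l \o lift ord0)) +
    h (u (lift l ord_max)) * Phi omega (u \o lift l \o lift ord_max).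
  rewrite Phi_extendE (bigD1 ord0) //= (bigD1 ord_max) /=; last first.
    by rewrite -val_eqE /=; lia.
  rewrite addn0 big1 ?addr0; last first.
    move=> j /andP[j0 jm]; rewrite h0 ?mul0r //.
    move: j0 jm (ltn_ord j); rewrite -!val_eqE /= /bump; lia.
  by rewrite addnn -mul2n exprM sqrrN !expr1n mul1r.
(* Dropping [ord0] leaves only the term at [u ord_max], and dropping [ord_max] only the one at
   [u ord0]. The two hypotheses thus give h(u_{n+1}) > 0 and (-1)^n h(u_0) > 0, which make both
   terms for [k] positive. *)
rewrite !PhiE.
rewrite (h0 (lift ord0 ord0)) ?mul0r ?add0r; last by rewrite /= /bump; lia.
rewrite (h0 (lift ord_max ord_max)) ?mul0r ?addr0; last first.
  by rewrite /= /bump; lia.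
rewrite pmulr_lgt0 // mulrA pmulr_lgt0 //.
have -> : lift ord0 ord_max = ord_max :> 'I_n.+2.
  by apply/val_inj; rewrite /= /bump; lia.
have -> : lift ord_max ord0 = ord0 :> 'I_n.+2.
  by apply/val_inj; rewrite /= /bump; lia.
have -> : lift k ord_max = ord_max :> 'I_n.+2.
  by apply/val_inj; rewrite /= /bump; lia.
have -> : lift k ord0 = ord0 :> 'I_n.+2.
  by apply/val_inj; rewrite /= /bump; lia.
by move=> hmax hmin; rewrite mulrA addr_gt0 // mulr_gt0.
Qed.

(** * Inserting points into a tuple *)

Lemma simplex_insert (R : realType) (n : nat) (I : set R)
  (hI : is_interval I) (y : 'I_n.+1 -> R) (hy : simplex I y) (t : R)
  (ht : y ord0 < t < y ord_max) (yt : forall i, y i != t) :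
  exists (u : 'I_n.+2 -> R) (k : 'I_n.+2),
    [/\ simplex I u, (0 < k < n.+1)%N, u k = t & u \o lift k = y].
Proof.
have /andP[t0 tm] := ht.
have inordn : inord n = ord_max :> 'I_n.+1 by apply/val_inj; rewrite /= inordK.
(* The rank of [t] in the enlarged tuple is the first index [m] with [t < y m]; since [t] lies
   strictly between the end points, 0 < m <= n. *)
have ex0 : exists m, t < y (inord m) by exists n; rewrite inordn.
pose m := ex_minn ex0.
have [tym ymin] : t < y (inord m) /\ forall i, t < y (inord i) -> (m <= i)%N.
  by rewrite /m; case: ex_minnP.
have mn : (m <= n)%N by apply: ymin; rewrite inordn.
have m0 : (0 < m)%N.
  rewrite lt0n; apply/eqP => m0; move: tym; rewrite m0.
  rewrite (_ : inord 0 = ord0); last by apply/val_inj; rewrite /= inordK.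
  by move=> /(lt_trans t0); rewrite ltxx.
have lo (i : 'I_n.+1) : (i < m)%N -> y i < t.
  move=> im; rewrite lt_neqAle yt leNgt; apply/negP => ti.
  by have := ymin i; rewrite inord_val => /(_ ti); lia.
have hi (i : 'I_n.+1) : (m <= i)%N -> t < y i.
  move=> im; apply: (lt_le_trans tym); apply: simplex_le hy _.
  by rewrite inordK //; lia.
have mS : (m < n.+2)%N by lia.
pose k := Ordinal mS.
pose u (j : 'I_n.+2) := if unlift k j is Some i then y i else t.
have uk : u k = t by rewrite /u unlift_none.
have ul i : u (lift k i) = y i by rewrite /u liftK.
exists u, k; split => //; last 2 first.
- by rewrite /=; lia.
- exact/funext.
have [Iy ylt] := hy.
split=> [j|i j].
  case: (unliftP k j) => [i ->|->]; rewrite ?ul ?uk //.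
  by apply: hI (Iy ord0) (Iy ord_max) _ _; rewrite !ltW.
case: (unliftP k j) => [j' ->|->]; case: (unliftP k i) => [i' ->|->];
  rewrite ?ul ?uk /= /bump => ij.
- by apply: ylt; lia.
- by apply: hi; lia.
- by apply: lo; lia.
- by lia.
Qed.

(** Contrapositive of [Phi_extend_interior]: if dropping either end of the enlarged tuple gave a
    positive value, so would dropping [t], which gives back [y]. The last clause is what makes the
    count of missed points decrease in repeated insertions. *)
Lemma Phi_nonpos_insert (R : realType) (n : nat) (hn : (0 < n)%N)
  (I : set R) (hI : is_interval I)
  (omega : 'I_n -> R -> R) (homega : positive_Chebyshev I omega)
  (g : R -> R) (y : 'I_n.+1 -> R) (hy : simplex I y)
  (gy : Phi (extend omega g) y <= 0) (t : R)
  (ht : y ord0 < t < y ord_max) (yt : forall i, y i != t) :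
  exists z : 'I_n.+1 -> R,
    [/\ simplex I z, Phi (extend omega g) z <= 0,
        y ord0 <= z ord0, z ord_max <= y ord_max &
        forall s, z ord0 < s < z ord_max -> (forall i, z i != s) ->
          s != t /\ forall i, y i != s].
Proof.
have [u [k [hu hk uk uy]]] := simplex_insert hI hy ht yt.
have y0 : y ord0 = u ord0.
  by rewrite -uy /=; congr u; apply/val_inj; rewrite /= /bump; lia.
have ym : y ord_max = u ord_max.
  by rewrite -uy /=; congr u; apply/val_inj; rewrite /= /bump; lia.
have drop (l : 'I_n.+2) : (l = ord0) \/ (l = ord_max) ->
    Phi (extend omega g) (u \o lift l) <= 0 ->
    exists z : 'I_n.+1 -> R,
    [/\ simplex I z, Phi (extend omega g) z <= 0,
        y ord0 <= z ord0, z ord_max <= y ord_max &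
        forall s, z ord0 < s < z ord_max -> (forall i, z i != s) ->
          s != t /\ forall i, y i != s].
  move=> hl gl; exists (u \o lift l); split => //.
  - exact: simplex_lift.
  - by rewrite y0; apply: simplex_le hu _.
  - by rewrite ym; apply: simplex_le hu _; rewrite -ltnS.
  move=> s /andP[s0 sm] us.
  (* A retained point differs from [s] by assumption; the dropped one is an end point of [u], so it
     lies outside the open interval containing [s]. *)
  have uls j : u j != s.
    case: (unliftP l j) => [i ->|->]; first exact: us.
    case: hl => ->.
      rewrite lt_eqF // (le_lt_trans _ s0) //; exact: simplex_le hu _.
    rewrite gt_eqF // (lt_le_trans sm) //.
    by apply: simplex_le hu _; rewrite -ltnS.
  split=> [|i]; first by rewrite -uk eq_sym uls.
  by rewrite -uy uls.
have [g0|g0] := lerP (Phi (extend omega g) (u \o lift ord0)) 0.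
  by apply: drop g0; left.
have [gm|gm] := lerP (Phi (extend omega g) (u \o lift ord_max)) 0.
  by apply: drop gm; right.
have := Phi_extend_interior hn homega hu hk g0 gm.
by rewrite uy ltNge gy.
Qed.

(* Each insertion decreases the number of points pt t that lie strictly between
   the ends of the tuple without belonging to it. *)
Lemma Phi_nonpos_refine (R : realType) (n : nat) (hn : (0 < n)%N)
  (I : set R) (hI : is_interval I)
  (omega : 'I_n -> R -> R) (homega : positive_Chebyshev I omega)
  (g : R -> R) (T : finType) (pt : T -> R)
  (y : 'I_n.+1 -> R) (hy : simplex I y) (gy : Phi (extend omega g) y <= 0) :
  exists z : 'I_n.+1 -> R,
    [/\ simplex I z, Phi (extend omega g) z <= 0,
        y ord0 <= z ord0, z ord_max <= y ord_max &
        forall t, z ord0 < pt t < z ord_max -> exists i, z i = pt t].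
Proof.
pose missed (y : 'I_n.+1 -> R) :=
  [set t | (y ord0 < pt t < y ord_max) && [forall i, y i != pt t]]%SET.
have [m] := ubnP #|missed y|; elim: m => // m IH in y hy gy *.
rewrite ltnS => ym; have [my|[t]] := set_0Vmem (missed y).
  exists y; split=> // t ht; apply: contrapT => nt.
  have : t \in missed y.
    rewrite inE ht; apply/forallP => i; apply/eqP => yi.
    by apply: nt; exists i.
  by rewrite my inE.
move=> tM; have := tM; rewrite inE => /andP[ht /forallP yt].
have [z [hz gz yz0 yzm zt]] := Phi_nonpos_insert hn hI homega hy gy ht yt.
have zy : (#|missed z| < m)%N.
  apply: leq_trans ym; apply: proper_card; apply/properP; split.
    apply/fintype.subsetP => s; rewrite !inE => /andP[hs /forallP zs].
    have [_ ys] := zt _ hs zs; case/andP: hs => s0 sm.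
    by rewrite (le_lt_trans yz0) // (lt_le_trans sm) //=; apply/forallP.
  exists t => //; rewrite inE; apply/negP => /andP[hs /forallP zs].
  by have [] := zt _ hs zs; rewrite eqxx.
have [v [hv gv zv0 zvm vt]] := IH z hz gz zy.
exists v; split => //; first exact: le_trans zv0.
exact: le_trans yzm.
Qed.

(** * Short tuples from a fine grid *)

(** A gap longer than [h] between consecutive points of [z] would contain a grid point strictly
    inside, contrary to [hit]; and [z] has only [n] gaps. *)
Lemma simplex_diameter_le (R : realType) (n : nat) (I : set R)
  (z : 'I_n.+1 -> R) (hz : simplex I z) (a b h : R) (h0 : 0 < h)
  (az : a <= z ord0) (zb : z ord_max <= b)
  (hit : forall k : 'I_(Num.trunc ((b - a) / h)).+2,
    z ord0 < a + k%:R * h < z ord_max -> exists i, z i = a + k%:R * h) :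
  z ord_max - z ord0 <= n%:R * h.
Proof.
have step (m : nat) : (m < n)%N -> z (inord m.+1) <= z (inord m) + h.
  move=> mn; rewrite leNgt; apply/negP => gap.
  have z0 : z ord0 <= z (inord m) by apply: simplex_le hz _.
  have zm : z (inord m.+1) <= z ord_max.
    by apply: simplex_le hz _; rewrite inordK.
  (* With k the integer part of (z_m - a) / h, one has a + k h <= z_m < a + (k+1) h <= z_m + h <
     z_{m+1}, so the grid point of index k+1 falls into the gap. *)
  have q0 : 0 <= (z (inord m) - a) / h by apply: divr_ge0; lra.
  have /andP[] := truncn_itv q0; set k := Num.trunc _.
  rewrite ler_pdivlMr // ltr_pdivrMr // => k1 k2.
  have kS : k.+1%:R * h = k%:R * h + h by rewrite -natr1 mulrDl mul1r.
  have kN : (k.+1 < (Num.trunc ((b - a) / h)).+2)%N.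
    rewrite -(ltr_nat R) (@le_lt_trans _ _ ((b - a) / h)) //.
      by rewrite ler_pdivlMr //; lra.
    by rewrite (lt_trans (truncnS_gt _)) // ltr_nat.
  have [|i zi] := hit (Ordinal kN); first by rewrite /=; apply/andP; split; lra.
  have [im|mi] := leqP i m.
    have : z i <= z (inord m) by apply: simplex_le hz _; rewrite inordK; lia.
    by rewrite zi /=; lra.
  have : z (inord m.+1) <= z i by apply: simplex_le hz _; rewrite inordK; lia.
  by rewrite zi /=; lra.
have all m : (m <= n)%N -> z (inord m) <= z ord0 + m%:R * h.
  elim: m => [_|m IH mn].
    rewrite mul0r addr0 (_ : inord 0 = ord0) //.
    by apply/val_inj; rewrite /= inordK.
  have := step _ mn; have := IH (ltnW mn); rewrite -natr1 mulrDl mul1r; lra.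
have := all n (leqnn n).
rewrite (_ : inord n = ord_max); last by apply/val_inj; rewrite /= inordK.
lra.
Qed.

Lemma Phi_nonpos_small (R : realType) (n : nat) (hn : (0 < n)%N)
  (I : set R) (hI : is_interval I)
  (omega : 'I_n -> R -> R) (homega : positive_Chebyshev I omega)
  (g : R -> R) (y : 'I_n.+1 -> R) (hy : simplex I y)
  (gy : Phi (extend omega g) y <= 0) (e : R) (e0 : 0 < e) :
  exists z : 'I_n.+1 -> R,
    [/\ simplex I z, Phi (extend omega g) z <= 0,
        y ord0 <= z ord0, z ord_max <= y ord_max &
        z ord_max - z ord0 < e].
Proof.
(* Dividing by n+1 rather than n makes the total length of the [n] gaps strictly smaller than
   [e]. *)
have h0 : 0 < e / n.+1%:R by rewrite divr_gt0.
have [z [hz gz yz0 yzm hit]] := Phi_nonpos_refine hn hI homega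
  (fun k : 'I_(Num.trunc ((y ord_max - y ord0) / (e / n.+1%:R))).+2 =>
     y ord0 + k%:R * (e / n.+1%:R)) hy gy.
exists z; split => //.
apply: le_lt_trans (simplex_diameter_le hz h0 yz0 yzm hit) _.
by rewrite mulrCA gtr_pMr // ltr_pdivrMr // mul1r ltr_nat.
Qed.

(** * Shrinking to a point *)

Lemma nested_intervals_inhabited (R : realType) (a b : nat -> R)
  (ha : forall k, a k <= a k.+1) (hb : forall k, b k.+1 <= b k)
  (ab : forall k, a k <= b k) : exists p, forall k, a k <= p <= b k.
Proof.
have ndb i j : (i <= j)%N -> b j <= b i.
  by move=> ij; move/nonincreasing_seqP : hb; apply.
have nda i j : (i <= j)%N -> a i <= a j.
  by move=> ij; move/nondecreasing_seqP : ha; apply.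
have aub k : ubound (range a) (b k).
  move=> _ [j _ <-]; apply: (le_trans (nda _ _ (leq_maxl j k))).
  by apply: (le_trans (ab _)); apply/ndb/leq_maxr.
exists (sup (range a)) => k; apply/andP; split.
  by apply: ub_le_sup; [exists (b 0%N) | exists k].
by apply: ge_sup; [exists (a k); exists k | exact: aub].
Qed.

(** The infimum is monotone in delta, so the limit exists; each infimum is at most [c] because the
    tuple given by [hc] competes in it. *)
Lemma lower_Dinghas_le (R : realType) (n : nat) (I : set R)
  (omega : 'I_n -> R -> R) (w f : R -> R) (p c : R)
  (hc : forall d, 0 < d -> exists y : 'I_n.+1 -> R,
    [/\ simplex I y, y ord0 <= p <= y ord_max, y ord_max - y ord0 < d &
        divided_difference omega w f y <= c]) :
  (lower_Dinghas I omega w f p <= c%:E)%E.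
Proof.
apply: lime_le.
  apply: nonincreasing_at_right_is_cvge; apply: nearW => e d1 d2 _ _ d12.
  apply: le_ereal_inf => _ [y [hy py yd] <-]; exists y => //; split => //.
  exact: lt_le_trans d12.
near=> d; have [|y [hy py yd yc]] := hc d; first by near: d; exact: nbhs_right_gt.
apply: ereal_inf_le; exists (divided_difference omega w f y)%:E.
  by exists y.
by rewrite lee_fin.
Unshelve. all: by end_near. Qed.

Unset Implicit Arguments.
Set Strict Implicit.

Theorem theorem10 (R : realType) (I : set R) (hI : nondegenerate_interval I)
  (n : nat) (hn : (0 < n)%N)
  (omega : 'I_n -> R -> R) (homega : positive_Chebyshev I omega)
  (w : R -> R) (hw : positive_Chebyshev I (extend omega w))
  (f : R -> R) (x : 'I_n.+1 -> R) (hx : simplex I x) :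
  exists p : R, x ord0 <= p <= x ord_max /\
    ((divided_difference omega w f x)%:E >= lower_Dinghas I omega w f p)%E.
Proof.
set c := divided_difference omega w f x.
have Phi_nonposP y : simplex I y ->
    (Phi (extend omega (fun t => f t - c * w t)) y <= 0) =
    (divided_difference omega w f y <= c).
  by move=> hy; rewrite Phi_extend_comb subr_le0 ler_pdivrMr //; exact: hw.
pose S := {y : 'I_n.+1 -> R | simplex I y /\ divided_difference omega w f y <= c}.
(* Pairing the tuple with a step number lets one choice function serve a length bound that changes
   from step to step. *)
have next (z : S * nat) : exists y : S,
    [/\ sval z.1 ord0 <= sval y ord0, sval y ord_max <= sval z.1 ord_max &
        sval y ord_max - sval y ord0 < z.2.+1%:R^-1].
  case: z => [[y [hy gy]] k] /=; rewrite -Phi_nonposP // in gy.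
  have e0 : 0 < k.+1%:R^-1 :> R by rewrite invr_gt0.
  have [z [hz gz y0 ym ze]] := Phi_nonpos_small hn hI.1 homega hy gy e0.
  rewrite Phi_nonposP // in gz.
  by exists (exist _ z (conj hz gz)).
have [F hF] := choice next.
pose Y := fix Y k : S := if k is k'.+1 then F (Y k', k')
  else exist _ x (conj hx (lexx c)).
have [p hp] : exists p, forall k, sval (Y k) ord0 <= p <= sval (Y k) ord_max.
  apply: (@nested_intervals_inhabited R (fun k => sval (Y k) ord0)
    (fun k => sval (Y k) ord_max)) => k.
  - by have [] := hF (Y k, k).
  - by have [] := hF (Y k, k).
  - by apply: simplex_le (svalP (Y k)).1 _.
exists p; split; first exact: hp 0%N.
apply: lower_Dinghas_le => d d0.
have [k kd] := ltr_add_invr d0; rewrite add0r in kd.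
(* The bound 1/(k+1) holds for the tuple produced at step [k], namely [Y k.+1]; the initial tuple
   [Y 0] is [x] itself. *)
have [hy yc] := svalP (Y k.+1).
exists (sval (Y k.+1)); split => //.
by have [_ _ /lt_trans] := hF (Y k, k); apply.
Qed.
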